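(* Let $(X,d)$, $\mathcal{B}$, $m$, $C$, $\lambda$, $L_C$, $\mathcal{T}_X$ be as in the context and let $W$ be a positive symmetric edge weight on $\mathcal{T}_X$. Assume that \[\kappa:=\lim_{k\to+\infty}\frac{\lambda(B_k(x))}{C(B_k(x))}\in(0,+\infty)\] exists and is independent of $x$, and that the convergence is locally uniform in $x$. Assume further that, for each fixed $k$, the series \[\sum_{j=k}^{+\infty}\frac{m(B_j(x))}{W(B_j(x),B_{j-1}(x))}\] converges and is locally bounded in $x$, and that \[\frac{W(B_k(x),B_{k-1}(x))}{m(B_k(x))}\sum_{j=k}^{+\infty}\frac{m(B_j(x))}{W(B_j(x),B_{j-1}(x))}\] converges, as $k\to+\infty$, locally uniformly in $x$ to a constant $\kappa_W\in(0,+\infty)$ independent of $x$. For $q\in\mathcal{S}_0(X)$ set \[G_Wq(x)=\frac1{\kappa_W}\sum_{B\in\mathcal{B},\,B\ni x}\frac1{W(B,B')}\int_Bq(y)\,dm(y).\] Then \[G_W=L_C^{-1}\text{ on }\mathcal{S}_0(X)\quad\Longleftrightarrow\quad W(B,B')=\frac1\kappa\,\frac{m(B)\lambda(B)\lambda(B')}{C(B)}\ \text{ for all }B\in\mathcal{B}.\] For the weight on the right-hand side, $\kappa_W=\kappa$.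
   Context: Space. $(X,d)$ is a noncompact, locally compact, separable, perfect ultrametric space; $\mathcal{B}$ is a countable basis of nonempty compact open balls; $m$ is a non-atomic Borel Radon measure of full support with $m(X)=+\infty$ and $0<m(B)<+\infty$ for all $B\in\mathcal{B}$. Every $B\in\mathcal{B}$ has a unique immediate strict super-ball $B'\in\mathcal{B}$; every ball in $\mathcal{B}$ is the disjoint union of finitely many (at least two) maximal proper sub-balls in $\mathcal{B}$. Any two balls in $\mathcal{B}$ are contained in a common ball of $\mathcal{B}$, reachable from either by finitely many iterations of $B\mapsto B'$; for each $B$ the union of its successive super-balls is $X$; along every infinite strictly descending chain of successive sub-balls the diameters tend to $0$. Tree. $\mathcal{T}_X$ has a vertex $v_B$ for each $B\in\mathcal{B}$ and an undirected edge between $v_B$ and $v_{B'}$ for each $B$. A height function $h:\mathcal{B}\to\mathbb{Z}$ with $h(B)-h(B')=1$ is fixed; balls of each height $k$ partition $X$, and $B_k(x)$ denotes the ball of height $k$ containing $x$, so $B_k(x)'=B_{k-1}(x)$. A positive symmetric edge weight is an assignment $W(B,B')=W(B',B)>0$ for every $B\in\mathcal{B}$. Functions. $\mathcal{S}(X)$ is the space of real-valued locally constant compactly supported functions on $X$, and $\mathcal{S}_0(X)=\{f\in\mathcal{S}(X):\int_Xf\,dm=0\}$. Hierarchical Laplacian. $C:\mathcal{B}\to(0,+\infty)$ is such that $\lambda(B):=\sum_{D\in\mathcal{B},D\supseteq B}C(D)<+\infty$ for every $B\in\mathcal{B}$ and $\lambda(B_k(x))\to+\infty$ as $k\to+\infty$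 for every $x\in X$. For $f\in\mathcal{S}(X)$, $L_Cf(x)=\sum_{B\in\mathcal{B},B\ni x}C(B)\bigl(f(x)-\frac1{m(B)}\int_Bf\,dm\bigr)$. The operator $L_C$ restricts to a bijection of $\mathcal{S}_0(X)$ onto itself, and $L_C^{-1}$ denotes the inverse of this restriction. *)

(* Defs.v *)
From HB Require Import structures.
From mathcomp Require Import all_boot all_order all_algebra.
From mathcomp Require Import all_classical all_reals all_analysis.

Set Implicit Arguments.
Unset Strict Implicit.
Unset Printing Implicit Defensive.

Import Order.TTheory GRing.Theory Num.Theory.
Import numFieldNormedType.Exports.

Local Open Scope classical_set_scope.
Local Open Scope ring_scope.

(* The sigma-algebra types of the library are pointed. The spaces considered
   below are nonempty, so the base point is no restriction; it is never used. *)
#[short(type="pmetricType")]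
HB.structure Definition PointedMetric (K : numDomainType) :=
  { M of Pointed M & Metric K M }.

Notation Borel X := (g_sigma_algebraType (@open X)).
Notation borel_measure X R := {measure set (Borel X) -> \bar R}.

Section Space.
Context {R : realType} {X : pmetricType R}.
Implicit Types (x y : X) (B D E : set X) (Bs : set (set X)).

Definition ultrametric :=
  forall x y z, mdist x z <= Num.max (mdist x y) (mdist y z).

Definition separable := exists2 D : set X, countable D & dense D.

(* In an ultrametric space [closed_ball] (the closure of the open ball) is the
   open ball itself, hence the explicit form of balls of the second kind. *)
Definition metric_ball B := exists x r, 0 < r /\
  (B = [set y | mdist x y < r] \/ B = [set y | mdist x y <= r]).

Definition diam B : R := sup [set mdist x y | x in B & y in B].

Definition immediate_super Bs B D :=
  [/\ Bs D, B `<` D & forall E, Bs E -> B `<` E -> ~ E `<` D].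

(* The super-ball B' of B, well defined for B in Bs by bb_super below. *)
Definition super Bs B : set X := xget set0 (immediate_super Bs B).

Definition maximal_sub Bs B : set (set X) := [set D |
  [/\ Bs D, D `<` B & forall E, Bs E -> E `<` B -> ~ D `<` E]].

Record ball_basis Bs : Prop := {
  bb_countable : countable Bs;
  bb_basis : basis Bs;
  bb_ball : forall B, Bs B -> [/\ metric_ball B, B !=set0, compact B & open B];
  bb_super : forall B, Bs B -> exists! D, immediate_super Bs B D;
  bb_sub_finite : forall B, Bs B -> finite_set (maximal_sub Bs B);
  bb_sub_two : forall B, Bs B ->
    exists D E, [/\ maximal_sub Bs B D, maximal_sub Bs B E & D <> E];
  bb_sub_disjoint : forall B, Bs B -> trivIset (maximal_sub Bs B) id;
  bb_sub_cover : forall B, Bs B -> \bigcup_(D in maximal_sub Bs B) D = B;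
  bb_common : forall B D, Bs B -> Bs D -> exists E,
    [/\ Bs E, B `<=` E, D `<=` E, (exists i, iter i (super Bs) B = E)
      & exists j, iter j (super Bs) D = E];
  bb_exhaust : forall B, Bs B -> \bigcup_n iter n (super Bs) B = setT;
  bb_chain : forall c : nat -> set X,
    Bs (c 0%N) -> (forall n, maximal_sub Bs (c n) (c n.+1)) ->
    diam (c n) @[n --> \oo] --> (0 : R)
}.

Definition radon (m : borel_measure X R) :=
  [/\ forall K, compact K -> (m K < +oo)%E,
      forall U, open U ->
        m U = ereal_sup [set m K | K in [set K | compact K /\ K `<=` U]]
    & forall A : set (Borel X), measurable A ->
        m A = ereal_inf [set m U | U in [set U : set X | open U /\ A `<=` U]]].

Definition non_atomic (m : borel_measure X R) :=
  forall A : set (Borel X), measurable A -> (0 < m A)%E ->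
    exists D : set (Borel X), [/\ measurable D, D `<=` A & (0 < m D < m A)%E].

Definition full_support (m : borel_measure X R) :=
  forall U : set X, open U -> U !=set0 -> (0 < m U)%E.

Record ultrametric_measure_space Bs (m : borel_measure X R) : Prop := {
  ums_noncompact : ~ compact [set: X];
  ums_locally_compact : locally_compact [set: X];
  ums_separable : separable;
  ums_perfect : perfect_set [set: X];
  ums_ultrametric : ultrametric;
  ums_basis : ball_basis Bs;
  ums_radon : radon m;
  ums_non_atomic : non_atomic m;
  ums_full_support : full_support m;
  ums_infinite : m setT = +oo%E;
  ums_ball : forall B, Bs B -> (0 < m B < +oo)%E
}.

Definition tree_edge Bs B D :=
  [/\ Bs B, Bs D & D = super Bs B \/ B = super Bs D].

Definition height_function Bs (h : set X -> int) :=
  forall B, Bs B -> h B - h (super Bs B) = 1.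

(* B_k(x): the balls of height k partition X, so the choice is unique. *)
Definition ball_at Bs (h : set X -> int) (k : int) x : set X :=
  xget set0 [set B | [/\ Bs B, B x & h B = k]].

Definition edge_weight Bs (W : set X -> set X -> R) :=
  forall B D, tree_edge Bs B D -> 0 < W B D /\ W B D = W D B.

Definition test_fun : set (X -> R) := [set f |
  (forall x, \forall y \near x, f y = f x) /\
  compact (closure [set x | f x != 0])].

Definition test_fun0 (m : borel_measure X R) : set (X -> R) :=
  [set f | test_fun f /\ \int[m]_x f x = 0].

Definition locally_bounded (f : X -> R) :=
  forall x, exists2 U, nbhs x U & [bounded f y | y in U].

Definition locally_uniform_cvg (F : nat -> X -> R) (f : X -> R) :=
  forall x, exists2 U, nbhs x U & {uniform U, F @ \oo --> f}.

(* Sum of an absolutely convergent family of reals: [esum] is only meant for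
   nonnegative families, so the positive and negative parts are summed apart. *)
Definition abs_sum (I : choiceType) (A : set I) (a : I -> R) : R :=
  fine (\esum_(i in A) (a^\+ i)%:E) - fine (\esum_(i in A) (a^\- i)%:E).

Section Laplacian.
Context (Bs : set (set X)) (m : borel_measure X R) (C : set X -> R).

Definition elambda B : \bar R :=
  (\esum_(D in [set D | Bs D /\ B `<=` D]) (C D)%:E)%E.

Definition lambda B : R := fine (elambda B).

Definition laplacian_coef (h : set X -> int) :=
  [/\ forall B, Bs B -> 0 < C B,
      forall B, Bs B -> (elambda B < +oo)%E
    & forall x, lambda (ball_at Bs h n%:Z x) @[n --> \oo] --> +oo].

Definition laplacian (f : X -> R) (x : X) : R :=
  abs_sum [set B | Bs B /\ B x]
    (fun B => C B * (f x - (fine (m B))^-1 * \int[m]_(y in B) f y)).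

(* The inverse of the restriction of L_C to S_0(X); the default value is only
   taken outside the image of that restriction. *)
Definition laplacian_inv : (X -> R) -> (X -> R) :=
  'pinv_(fun=> cst 0) (test_fun0 m) laplacian.

End Laplacian.

Section Weight.
Context (Bs : set (set X)) (h : set X -> int) (m : borel_measure X R).
Context (W : set X -> set X -> R).

Definition weight_term (x : X) (j : int) : R :=
  fine (m (ball_at Bs h j x)) / W (ball_at Bs h j x) (ball_at Bs h (j - 1) x).

Definition weight_series (k : int) (x : X) : R^nat :=
  series (fun n => weight_term x (k + n%:Z)).

(* kappaW is the constant kappa_W of the weight W: the tail series converge,
   with locally bounded sums, and their normalization tends to kappaW. *)
Record has_kappa_weight (kappaW : R) : Prop := {
  hkw_cvg : forall k x, cvgn (weight_series k x);
  hkw_bounded : forall k, locally_bounded (fun x => limn (weight_series k x));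
  hkw_gt0 : 0 < kappaW;
  hkw_lim : locally_uniform_cvg
    (fun n x => W (ball_at Bs h n%:Z x) (ball_at Bs h (n%:Z - 1) x)
                / fine (m (ball_at Bs h n%:Z x))
                * limn (weight_series n%:Z x))
    (cst kappaW)
}.

Definition green (kappaW : R) (q : X -> R) (x : X) : R :=
  kappaW^-1 * abs_sum [set B | Bs B /\ B x]
    (fun B => (W B (super Bs B))^-1 * \int[m]_(y in B) q y).

End Weight.

Definition matching_weight Bs (m : borel_measure X R) (C : set X -> R)
    (kappa : R) (W : set X -> set X -> R) :=
  forall B, Bs B -> W B (super Bs B) =
    kappa^-1 * (fine (m B) * lambda Bs C B * lambda Bs C (super Bs B) / C B).

End Space.

(* Main.v *)
Require Import Defs.
From HB Require Import structures.
From mathcomp Require Import all_boot all_order all_algebra.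
From mathcomp Require Import all_classical all_reals all_analysis.
From mathcomp Require Import ring lra zify.

Set Implicit Arguments.
Unset Strict Implicit.
Unset Printing Implicit Defensive.

Import Order.TTheory GRing.Theory Num.Theory.
Import numFieldNormedType.Exports.

Local Open Scope classical_set_scope.
Local Open Scope ring_scope.

(* For a ball D let haar D = 1_D / m(D) - 1_D' / m(D'). Telescoping along the
   chain D, D', D'', ... shows that these functions span S_0(X). They are
   eigenfunctions of L_C with eigenvalue lambda(D'), and
     G_W (haar D) (x) = kappa_W^-1 * S(x, h D) * haar D x,
   where S(x, k) is the tail sum over j >= k of m(B_j(x)) / W(B_j(x), B_j-1(x)).
   Hence G_W inverts L_C iff S(x, k) = kappa_W / lambda(B_k-1(x)) for all x, k.
   Taking differences in k, and using lambda(B) - lambda(B') = C(B), this is the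
   formula for W with kappa_W in place of kappa; conversely that formula makes
   the tail sums telescope, because lambda(B_k(x)) tends to infinity. In both
   cases the normalized tail sum equals lambda(B_k(x)) / C(B_k(x)), so that
   kappa_W = kappa. Injectivity of L_C on S_0(X) comes for free: the Green
   operator of a weight satisfying the formula is a left inverse. *)

(** * Sums of absolutely summable real families *)

Section AbsSum.
Context {R : realType} {I : choiceType}.
Implicit Types (A : set I) (a b u v : I -> R).
Local Notation summableR A a := (summable A (EFin \o a)).

Lemma eq_abs_sum A a b :
  (forall i, A i -> a i = b i) -> abs_sum A a = abs_sum A b.
Proof.
move=> ab; rewrite /abs_sum.
congr (fine _ - fine _); apply: eq_esum => i Ai;
  by rewrite /funrpos /funrneg ab.
Qed.

Lemma eq_summable A a b : (forall i, A i -> a i = b i) ->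
  summableR A a -> summableR A b.
Proof.
move=> ab; rewrite /summable.
rewrite (@eq_esum _ _ _ _ (fun i => `|(EFin \o b) i|%E))// => i Ai /=.
by rewrite ab.
Qed.

Lemma ge0_summable A u : (forall i, A i -> 0 <= u i) ->
  (\esum_(i in A) (u i)%:E < +oo)%E -> summableR A u.
Proof.
move=> u0; apply: le_lt_trans; apply: le_esum => i Ai /=.
by rewrite lee_fin ger0_norm// u0.
Qed.

Lemma ge0_esumZl A u (c : R) : 0 <= c -> (forall i, A i -> 0 <= u i) ->
  (\esum_(i in A) (c * u i)%:E = c%:E * \esum_(i in A) (u i)%:E)%E.
Proof.
have le (d : R) w : 0 <= d -> (forall i, A i -> 0 <= w i) ->
    (\esum_(i in A) (d * w i)%:E <= d%:E * \esum_(i in A) (w i)%:E)%E.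
  move=> d0 w0; apply: ge_ereal_sup => _ [F [finF FA] <-].
  rewrite (_ : (\sum_(i \in F) _)%E = (d%:E * \sum_(i \in F) (w i)%:E)%E).
    by rewrite lee_wpmul2l ?lee_fin//; apply: ereal_sup_ubound; exists F.
  by rewrite !fsumEFin// -EFinM mulr_fsumr.
rewrite le_eqVlt => /predU1P[<- u0|c0 u0].
  by rewrite mul0e esum1// => i _; rewrite mul0r.
(* The reverse inequality is [le] again, for the factor [c^-1] and the family [c * u i]. *)
apply/eqP; rewrite eq_le le ?(ltW c0)//= -lee_pdivlMl//.
rewrite [leLHS](@eq_esum _ _ _ _ (fun i => (c^-1 * (c * u i))%:E)); last first.
  by move=> i _; rewrite mulKf// gt_eqF.
by apply: le => [|i Ai]; rewrite ?invr_ge0 ?mulr_ge0 ?(ltW c0) ?u0.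
Qed.

Lemma summableZl A a (c : R) : summableR A a -> summableR A (fun i => c * a i).
Proof.
rewrite /summable (@eq_esum _ _ _ (fun i => `|(EFin \o a) i|%E)
  (fun i => (`|a i|)%:E))// => sa.
rewrite (@eq_esum _ _ _ _ (fun i => (`|c| * `|a i|)%:E)); last first.
  by move=> i _; rewrite /= normrM.
rewrite ge0_esumZl// -(@fineK _ (\esum_(i in A) `|a i|%:E)%E) ?ltry//.
rewrite ge0_fin_numE// esum_ge0// => i _; rewrite lee_fin//.
Qed.

Lemma ge0_abs_sum A u : (forall i, A i -> 0 <= u i) ->
  abs_sum A u = fine (\esum_(i in A) (u i)%:E).
Proof.
move=> u0; rewrite /abs_sum [X in _ - fine X]esum1 ?subr0.
  by congr fine; apply: eq_esum => i Ai; rewrite /funrpos max_l ?u0.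
by move=> i Ai; rewrite /funrneg max_r ?oppr_le0 ?u0.
Qed.

(** Both parts of [u - v] are dominated by [u + v], so all four sums are finite. Summing the
    pointwise identity (u - v)^+ + v = u + (u - v)^- over nonnegative families and rearranging gives
    the claim. *)
Lemma abs_sumB A u v : (forall i, A i -> 0 <= u i) ->
  (forall i, A i -> 0 <= v i) -> summableR A u -> summableR A v ->
  abs_sum A (fun i => u i - v i) = abs_sum A u - abs_sum A v.
Proof.
move=> u0 v0 su sv; rewrite (ge0_abs_sum u0) (ge0_abs_sum v0).
have fin (w : I -> R) : (forall i, A i -> 0 <= w i) -> summableR A w ->
    \esum_(i in A) (w i)%:E \is a fin_num.
  move=> w0; rewrite summableE (@eq_esum _ _ _ _ (fun i => (w i)%:E))//.
  by move=> i Ai; rewrite /= ger0_norm ?w0.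
have sp : summableR A (fun i => u i - v i)^\+.
  have : summableR A (fun i => u i + v i) by exact: summableD su sv.
  apply: le_lt_trans; apply: le_esum => i Ai /=; rewrite lee_fin.
  have := u0 i Ai; have := v0 i Ai => vi ui.
  rewrite !ger0_norm ?addr_ge0 ?funrpos_ge0//.
  by rewrite /funrpos ge_max addr_ge0// andbT lerD2l; lra.
have sn : summableR A (fun i => u i - v i)^\-.
  have : summableR A (fun i => u i + v i) by exact: summableD su sv.
  apply: le_lt_trans; apply: le_esum => i Ai /=; rewrite lee_fin.
  have := u0 i Ai; have := v0 i Ai => vi ui.
  rewrite !ger0_norm ?addr_ge0 ?funrneg_ge0//.
  by rewrite /funrneg ge_max addr_ge0// andbT opprB addrC lerD2r; lra.
have fp : \esum_(i in A) ((fun i => u i - v i)^\+ i)%:E \is a fin_num.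
  by apply: fin => // i _; exact: funrpos_ge0.
have fn : \esum_(i in A) ((fun i => u i - v i)^\- i)%:E \is a fin_num.
  by apply: fin => // i _; exact: funrneg_ge0.
have aux (p n x y : R) : p + y = x + n -> p - n = x - y by lra.
rewrite /abs_sum; apply: aux; rewrite -!fineD ?fin//; congr fine.
rewrite -!esumD//=.
all: try by move=> i Ai; rewrite lee_fin ?u0 ?v0 ?funrpos_ge0 ?funrneg_ge0.
apply: eq_esum => i Ai; rewrite -!EFinD; congr EFin.
rewrite -[u i](subrK (v i)).
have /(congr1 (@^~ i)) <- := funrposBneg (fun i => u i - v i).
rewrite !fctE /=; ring.
Qed.

Lemma abs_sumN A a : abs_sum A (fun i => - a i) = - abs_sum A a.
Proof.
rewrite /abs_sum opprB; congr (fine _ - fine _); apply: eq_esum => i Ai.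
by rewrite /funrpos /funrneg opprK.
Qed.

Let abs_sum_posneg A a : abs_sum A a = abs_sum A a^\+ - abs_sum A a^\-.
Proof.
by rewrite (@ge0_abs_sum _ a^\+) ?(@ge0_abs_sum _ a^\-)// => i _;
  rewrite ?funrpos_ge0 ?funrneg_ge0.
Qed.

Let summable_pos A a : summableR A a -> summableR A a^\+.
Proof.
apply: le_lt_trans; apply: le_esum => i Ai /=; rewrite lee_fin.
by rewrite ger0_norm ?funrpos_ge0// /funrpos ge_max ler_norm normr_ge0.
Qed.

Let summable_neg A a : summableR A a -> summableR A a^\-.
Proof.
apply: le_lt_trans; apply: le_esum => i Ai /=; rewrite lee_fin.
by rewrite ger0_norm ?funrneg_ge0// /funrneg ge_max -normrN ler_norm normr_ge0.
Qed.

Let ge0_abs_sumD A u v : (forall i, A i -> 0 <= u i) ->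
  (forall i, A i -> 0 <= v i) -> summableR A u -> summableR A v ->
  abs_sum A (fun i => u i + v i) = abs_sum A u + abs_sum A v.
Proof.
move=> u0 v0 su sv; have uv : abs_sum A u = abs_sum A
    (fun i => (fun i => u i + v i) i - v i).
  by apply: eq_abs_sum => i _; rewrite addrK.
rewrite uv abs_sumB ?subrK// => [i Ai|]; first by rewrite addr_ge0 ?u0 ?v0.
exact: summableD su sv.
Qed.

(** Regroup [a + b] as (a^+ + b^+) - (a^- + b^-), a difference of nonnegative summable families, and
    apply [abs_sumB]. *)
Lemma abs_sumD A a b : summableR A a -> summableR A b ->
  abs_sum A (fun i => a i + b i) = abs_sum A a + abs_sum A b.
Proof.
move=> sa sb.
have [sap sbp] := (summable_pos sa, summable_pos sb).
have [san sbn] := (summable_neg sa, summable_neg sb).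
rewrite (@eq_abs_sum _ _ (fun i => (fun i => a^\+ i + b^\+ i) i -
  (fun i => a^\- i + b^\- i) i)); last first.
  move=> i _; rewrite -{1}[a]funrposBneg -{1}[b]funrposBneg !fctE; ring.
have p0 (f : I -> R) i : A i -> 0 <= f^\+ i by move=> _; exact: funrpos_ge0.
have n0 (f : I -> R) i : A i -> 0 <= f^\- i by move=> _; exact: funrneg_ge0.
rewrite abs_sumB.
- rewrite !ge0_abs_sumD; do ?[exact: p0|exact: n0|by []].
  by rewrite (abs_sum_posneg _ a) (abs_sum_posneg _ b); ring.
- by move=> i Ai; rewrite addr_ge0 ?p0.
- by move=> i Ai; rewrite addr_ge0 ?n0.
- exact: summableD sap sbp.
- exact: summableD san sbn.
Qed.

Lemma abs_sumZ A a (c : R) : abs_sum A (fun i => c * a i) = c * abs_sum A a.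
Proof.
(* This covers infinite [x] as well: [fine] sends both infinities to 0, and 0 times an infinity is
   0. *)
have fineZ (x : \bar R) : fine (c%:E * x)%E = c * fine x.
  by case: x => [r| |]//=; rewrite mulr_infty mulr0; case: sgrP;
    rewrite ?mul0e ?mul1e ?mulN1e.
(* A negative factor exchanges the positive and negative parts, which [abs_sumN] accounts for. *)
wlog c0 : c fineZ / 0 <= c => [H|].
  have [/(H _ fineZ)//|c0] := leP 0 c.
  rewrite -[c]opprK mulNr -H ?oppr_ge0 ?ltW//.
    by rewrite -abs_sumN; apply: eq_abs_sum => i _; rewrite mulNr.
  by move=> x; rewrite EFinN mulNe fineN fineZ mulNr.
rewrite /abs_sum mulrBr -!fineZ -!ge0_esumZl//.
congr (fine _ - fine _); apply: eq_esum => i _.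
  by rewrite /funrpos maxr_pMr// mulr0.
by rewrite /funrneg maxr_pMr// mulr0 mulrN.
Qed.

End AbsSum.

(** * The tree of balls *)

Section Tree.
Context {R : realType} {X : pmetricType R} {Bs : set (set X)}.
Hypotheses (uX : @ultrametric R X) (bB : ball_basis Bs).
Implicit Types (x y : X) (B D E : set X).

(** The centre [a] is strictly closer to [x] and [y] than to [z]. The ultrametric inequality then
    gives d(a,z) <= d(x,z) and d(x,y) <= max(d(x,a), d(a,y)) < d(a,z). *)
Lemma metric_ball_sep B x y z : metric_ball B -> B x -> B y -> ~ B z ->
  mdist x y < mdist x z.
Proof.
move=> [a [r [r0 Br]]] Bx By Bz.
have [ax ay] : mdist a x < mdist a z /\ mdist a y < mdist a z.
  case: Br => BE; move: Bx By Bz; rewrite BE /= => xr yr /negP.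
    by rewrite -leNgt => rz; split; exact: lt_le_trans rz.
  by rewrite -ltNge => rz; split; exact: le_lt_trans rz.
have xz : mdist a z <= mdist x z.
  have := uX a x z; rewrite le_max => /orP[/(lt_le_trans ax)|//].
  by rewrite ltxx.
apply: le_lt_trans (uX x a y) _.
by rewrite gt_max (metric_sym x a) (lt_le_trans ax xz) (lt_le_trans ay xz).
Qed.

(** Otherwise pick [y] in [B] outside [D] and [z] in [D] outside [B]: by [metric_ball_sep] each of
    d(x,y) and d(x,z) would be strictly smaller than the other. *)
Lemma nested B D x : Bs B -> Bs D -> B x -> D x -> B `<=` D \/ D `<=` B.
Proof.
move=> BB BD Bx Dx; apply: contrapT => /not_orP[].
move=> /existsNP[y /not_implyP[By Dy]] /existsNP[z /not_implyP[Dz Bz]].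
have [mB _ _ _] := bb_ball bB BB; have [mD _ _ _] := bb_ball bB BD.
have := lt_trans (metric_ball_sep mB Bx By Bz) (metric_ball_sep mD Dx Dz Dy).
by rewrite ltxx.
Qed.

Lemma superP B : Bs B -> immediate_super Bs B (super Bs B).
Proof.
move=> /(bb_super bB)[D [imD _]].
exact: (@xgetI _ _ (immediate_super Bs B) D).
Qed.

Lemma super_in B : Bs B -> Bs (super Bs B).
Proof. by move=> /superP[]. Qed.

Lemma super_proper B : Bs B -> B `<` super Bs B.
Proof. by move=> /superP[]. Qed.

Lemma super_sub B : Bs B -> B `<=` super Bs B.
Proof. by move=> /super_proper/properW. Qed.

Lemma ball_nonempty B : Bs B -> B !=set0.
Proof. by move=> /(bb_ball bB)[]. Qed.

Lemma super_min B E : Bs B -> Bs E -> B `<` E -> super Bs B `<=` E.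
Proof.
move=> BB BE BltE; have [x Bx] := ball_nonempty BB.
have [_ _ noE] := superP BB.
have Ex : E x by apply: (properW BltE).
have [//|ES] := nested (super_in BB) BE (super_sub BB Bx) Ex.
apply: contrapT => nSE; apply: noE BE BltE _; split=> //.
Qed.

(** Maximality of [D] below [B] says exactly that no basis ball lies strictly between them, so
    uniqueness of the immediate super-ball applies. *)
Lemma maximal_sub_super B D : Bs B -> maximal_sub Bs B D -> super Bs D = B.
Proof.
move=> BB [BD DB noE]; have [S [_ uS]] := bb_super bB BD.
rewrite -(uS _ (superP BD)); apply: uS; split=> // E BE DE EB.
exact: noE BE EB DE.
Qed.

Lemma iter_super_in n B : Bs B -> Bs (iter n (super Bs) B).
Proof. by move=> BB; elim: n => //= n; exact: super_in. Qed.

Lemma iter_super_sub n B : Bs B -> B `<=` iter n (super Bs) B.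
Proof.
move=> BB; elim: n => //= n IH.
by apply: subset_trans IH _; apply: super_sub; exact: iter_super_in.
Qed.

(** Take the least [n] whose iterate contains [D]; a common super-ball provides one. If [n] is
    positive, the previous iterate is nested with [D] without containing it, hence lies strictly
    inside [D], and [super_min] gives the other inclusion. *)
Lemma sub_iter_super B D : Bs B -> Bs D -> B `<=` D ->
  exists n, iter n (super Bs) B = D.
Proof.
move=> BB BD BD_sub; have [x Bx] := ball_nonempty BB.
have [E [_ _ DE [i BE] _]] := bb_common bB BB BD.
have : exists n, `[< D `<=` iter n (super Bs) B >].
  by exists i; apply/asboolP; rewrite BE.
move=> /ex_minnP[[|n] /asboolP Dn minn].
  by exists 0%N => /=; apply/seteqP.
exists n.+1; apply/seteqP; split=> //=.
have Bn := iter_super_in n BB; have nx := iter_super_sub n BB Bx.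
apply: super_min => //; split; last first.
  by move=> /asboolP/minn; rewrite ltnn.
have [//|Dn'] := nested Bn BD nx (BD_sub _ Bx).
by have := minn n (asboolT Dn'); rewrite ltnn.
Qed.

Lemma proper_super_sub B D x : Bs B -> Bs D -> B x -> D x ->
  D `<` super Bs B -> D `<=` B.
Proof.
move=> BB BD Bx Dx DS; have [BlD|//] := nested BB BD Bx Dx.
apply: contrapT => nDB; have := super_min BB BD (conj BlD nDB).
by case: DS.
Qed.

(** * Heights and the balls of given height through a point *)

Section Height.
Context (h : set X -> int).
Hypothesis hh : height_function Bs h.

Lemma height_super B : Bs B -> h (super Bs B) = h B - 1.
Proof. by move=> /hh; lia. Qed.

Lemma height_iter n B : Bs B -> h (iter n (super Bs) B) = h B - n%:Z.
Proof.
move=> BB; elim: n => [|n IH] /=; first by rewrite subr0.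
by rewrite height_super ?IH; [lia|exact: iter_super_in].
Qed.

Lemma sub_heightE B D x : Bs B -> Bs D -> B x -> D x ->
  B `<=` D <-> h D <= h B.
Proof.
move=> BB BD Bx Dx; split=> [BsD|hDB].
  by have [n <-] := sub_iter_super BB BD BsD; rewrite height_iter//; lia.
have [//|DsB] := nested BB BD Bx Dx.
have [n nE] := sub_iter_super BD BB DsB.
case: n nE => [<- //|n nE]; move: hDB; rewrite -nE height_iter// => hDB; lia.
Qed.

Lemma height_inj B D x : Bs B -> Bs D -> B x -> D x -> h B = h D -> B = D.
Proof.
move=> BB BD Bx Dx hE; apply/seteqP; split.
  by apply/(sub_heightE BB BD Bx Dx); rewrite hE.
by apply/(sub_heightE BD BB Dx Bx); rewrite hE.
Qed.

Lemma ball_exists x : exists2 B, Bs B & B x.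
Proof.
have [_ /(_ x setT (filterT)) [U [BU Ux] _]] := bb_basis bB.
by exists U.
Qed.

Lemma ball_atP (k : int) x :
  [/\ Bs (ball_at Bs h k x), ball_at Bs h k x x & h (ball_at Bs h k x) = k].
Proof.
have [B BB Bx] := ball_exists x.
apply: (@xgetPex _ set0 [set B | [/\ Bs B, B x & h B = k]]).
(* Heights above that of [B] are reached by descending: the maximal sub-balls cover [D], and the one
   through [x] has super-ball [D], so its height is one more. *)
have sub_ball n : exists D, [/\ Bs D, D x & h D = h B + n%:Z].
  elim: n => [|n [D [BD Dx hD]]]; first by exists B; rewrite addr0.
  have := bb_sub_cover bB BD => /seteqP[_ /(_ x Dx)[E mE Ex]].
  have [BE _ _] := mE; exists E; split=> //.
  by have := hh BE; rewrite (maximal_sub_super BD mE) hD; lia.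
have [kB|kB] := leP k (h B).
  exists (iter `|h B - k|%N (super Bs) B) => /=; split.
  - exact: iter_super_in.
  - exact: iter_super_sub.
  - by rewrite height_iter//; lia.
have [D [BD Dx hD]] := sub_ball `|k - h B|%N.
by exists D; split=> //; rewrite hD; lia.
Qed.

Lemma ball_at_in k x : Bs (ball_at Bs h k x).
Proof. by case: (ball_atP k x). Qed.

Lemma ball_at_mem k x : ball_at Bs h k x x.
Proof. by case: (ball_atP k x). Qed.

Lemma height_ball_at k x : h (ball_at Bs h k x) = k.
Proof. by case: (ball_atP k x). Qed.

Lemma ball_atE B x : Bs B -> B x -> ball_at Bs h (h B) x = B.
Proof.
move=> BB Bx; have [BD Dx hD] := ball_atP (h B) x.
exact: height_inj Dx Bx hD.
Qed.

Lemma super_ball_at k x : super Bs (ball_at Bs h k x) = ball_at Bs h (k - 1) x.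
Proof.
have BB := ball_at_in k x; have Sx := super_sub BB (ball_at_mem k x).
by rewrite -(ball_atE (super_in BB) Sx) height_super ?height_ball_at.
Qed.

Lemma ball_at_eq k x y : ball_at Bs h k x y ->
  ball_at Bs h k y = ball_at Bs h k x.
Proof.
by move=> /(ball_atE (ball_at_in k x)); rewrite height_ball_at.
Qed.

Lemma nbhs_ball_at k x : nbhs x (ball_at Bs h k x).
Proof.
have [_ _ _ oB] := bb_ball bB (ball_at_in k x).
by apply: open_nbhs_nbhs; split=> //; exact: ball_at_mem.
Qed.

End Height.
End Tree.

(** * Haar functions and the space of test functions of integral zero *)

Section Haar.
Context {R : realType} {X : pmetricType R} {Bs : set (set X)}.
Context {m : borel_measure X R}.
Hypothesis hX : ultrametric_measure_space Bs m.
Implicit Types (x y : X) (B D E : set X).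

Let uX := ums_ultrametric hX.
Let bB := ums_basis hX.

Definition mass (B : set X) : R := fine (m B).

Lemma ball_closed B : Bs B -> closed B.
Proof.
move=> /(bb_ball bB)[_ _ cB _]; apply: compact_closed => //.
exact: metric_hausdorff.
Qed.

Lemma ball_open B : Bs B -> open B.
Proof. by move=> /(bb_ball bB)[]. Qed.

Lemma open_measurable_Borel (U : set X) :
  open U -> measurable (U : set (Borel X)).
Proof. exact: sub_sigma_algebra. Qed.

Lemma ball_measurable B : Bs B -> measurable (B : set (Borel X)).
Proof. by move=> /ball_open/open_measurable_Borel. Qed.

Lemma mass_gt0 B : Bs B -> 0 < mass B.
Proof. by move=> /(ums_ball hX); exact: fine_gt0. Qed.

Lemma massE B : Bs B -> m B = (mass B)%:E.
Proof.
move=> /(ums_ball hX)/andP[B0 Boo].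
by rewrite fineK// ge0_fin_numE// ltW.
Qed.

(** The difference of the two balls is nonempty, and it is open because [B] is compact, hence
    closed; full support makes its mass positive. *)
Lemma mass_super B : Bs B -> mass B < mass (super Bs B).
Proof.
move=> BB; have BS := super_in bB BB.
have [sub nsub] := super_proper bB BB.
rewrite -lte_fin -!massE//.
rewrite -[in ltRHS](setDUK sub) measureU//=; last 3 first.
- exact: ball_measurable.
- by apply: measurableD; exact: ball_measurable.
- by rewrite setDIK.
rewrite lteDl; last by rewrite massE.
apply: (ums_full_support hX).
  by apply: openI; [exact: ball_open|exact: closed_openC (ball_closed BB)].
by move: nsub => /existsNP[y /not_implyP[Sy By]]; exists y.
Qed.

Lemma integrable_ball B : Bs B ->
  m.-integrable setT (EFin \o (\1_B : X -> R)).
Proof.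
move=> BB; apply/integrableP; split.
  apply/measurable_realfun.measurable_EFinP.
  exact: measurable_realfun.measurable_indic (ball_measurable BB).
rewrite (eq_integral (fun x : Borel X => (\1_B x)%:E)); last first.
  by move=> t _; rewrite gee0_abs// lee_fin.
rewrite integral_indic ?setIT//; last exact: ball_measurable.
by case/andP: (ums_ball hX BB).
Qed.

Lemma integral_ball A B : measurable (A : set (Borel X)) -> Bs B ->
  \int[m]_(x in A) \1_B x = mass (B `&` A).
Proof.
move=> mA BB; rewrite /Rintegral integral_indic//; exact: ball_measurable.
Qed.

Definition haar D x : R :=
  (mass D)^-1 * \1_D x - (mass (super Bs D))^-1 * \1_(super Bs D) x.

Lemma integrable_haar D : Bs D -> m.-integrable setT (EFin \o haar D).
Proof.
move=> BD; have iZ B c : Bs B ->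
    m.-integrable setT (fun x : Borel X => c%:E * (\1_B x)%:E)%E.
  by move=> BB; exact: integrableZl (integrable_ball BB).
exact: integrableB (iZ _ _ BD) (iZ _ _ (super_in bB BD)).
Qed.

Lemma integral_haar A D : measurable (A : set (Borel X)) -> Bs D ->
  \int[m]_(x in A) haar D x = (mass D)^-1 * mass (D `&` A) -
    (mass (super Bs D))^-1 * mass (super Bs D `&` A).
Proof.
move=> mA BD; have BS := super_in bB BD.
have iA B : Bs B -> m.-integrable A (EFin \o (\1_B : X -> R)).
  by move=> BB; apply: integrableS (integrable_ball BB).
rewrite RintegralB//.
- by rewrite !RintegralZl ?integral_ball//; exact: iA.
- exact: (integrableZl mA _ (iA _ BD)).
- exact: (integrableZl mA _ (iA _ BS)).
Qed.

Lemma integral_haar_super A D : measurable (A : set (Borel X)) -> Bs D ->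
  super Bs D `<=` A -> \int[m]_(x in A) haar D x = 0.
Proof.
move=> mA BD SA; have BS := super_in bB BD.
have DA := subset_trans (super_sub bB BD) SA.
rewrite integral_haar// (setIidl SA) (setIidl DA) !mulVf ?subrr//.
  by rewrite gt_eqF// mass_gt0.
by rewrite gt_eqF// mass_gt0.
Qed.

Lemma haar_out D x : Bs D -> ~ super Bs D x -> haar D x = 0.
Proof.
move=> BD Sx; have Dx : ~ D x by move/(super_sub bB BD).
by rewrite /haar !indicE !memNset// !mulr0 subrr.
Qed.

(** The strict mass increase separates the two reciprocals on [D]; off [D] only the second term is
    left. This allows cancelling a Haar value at any point of the super-ball. *)
Lemma haar_neq0 D x : Bs D -> super Bs D x -> haar D x != 0.
Proof.
move=> BD Sx; rewrite /haar !indicE (mem_set Sx) mulr1.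
have M := mass_super BD; have M0 := mass_gt0 BD.
have S0 := lt_trans M0 M.
have [Dx|nDx] := pselect (D x).
  rewrite (mem_set Dx) mulr1 subr_eq0; apply/negP => /eqP/invr_inj.
  by move/eqP; rewrite lt_eqF.
by rewrite memNset// mulr0 sub0r oppr_eq0 invr_eq0 gt_eqF.
Qed.

(** A ball strictly inside [super Bs D] is either contained in [D] or disjoint from it. *)
Lemma haar_cst B D x y : Bs B -> Bs D -> B `<` super Bs D -> B x -> B y ->
  haar D x = haar D y.
Proof.
move=> BB BD BS Bx By; have [sub _] := BS.
have DE z t : B z -> B t -> D z -> D t.
  by move=> Bz Bt Dz; apply: (proper_super_sub uX bB BD BB Dz Bz BS).
rewrite /haar !indicE (mem_set (sub _ Bx)) (mem_set (sub _ By)).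
have [Dx|nDx] := pselect (D x).
  by rewrite (mem_set Dx) mem_set//; exact: DE Dx.
by rewrite !memNset//; apply: contra_not nDx; exact: DE.
Qed.

(** Strictly inside [super Bs D] the Haar function is constant on [B]; if [B] contains [super Bs D]
    the integral vanishes, and if they are disjoint the function does. Factoring out [haar D x]
    turns the series of both operators into that value times a nonnegative series. *)
Lemma integral_haar_ball B D x : Bs B -> Bs D -> B x ->
  \int[m]_(y in B) haar D y =
  haar D x * (if `[< B `<` super Bs D >] then mass B else 0).
Proof.
move=> BB BD Bx; have mB := ball_measurable BB.
case: asboolP => [BS|nBS].
  rewrite -Rintegral_cst//; apply: eq_Rintegral => y /set_mem By.
  exact: haar_cst BS By Bx.
rewrite mulr0; have [SB|nSB] := pselect (super Bs D `<=` B).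
  exact: integral_haar_super.
have [[z [Bz Sz]]|disj] := pselect (B `&` super Bs D !=set0).
  exfalso; have [BS|//] := nested uX bB BB (super_in bB BD) Bz Sz.
  by apply: nBS; split.
transitivity (\int[m]_(y in B) cst (0 : R) y).
  apply: eq_Rintegral => y /set_mem By; apply: haar_out => // Sy.
  by apply: disj; exists y.
by rewrite Rintegral_cst// mul0r.
Qed.

End Haar.
Arguments mass {R X} m B.
Arguments haar {R X} Bs m D x.

(** * Linear spans of families of functions *)

Section LinSpan.
Context {R : realType} {T : Type}.
Implicit Types (P Q : set (T -> R)) (f g : T -> R).

(** Combinations are built one generator at a time, so that linear statements are proved by
    induction from their effect on a single generator. *)
Inductive lin_span P : (T -> R) -> Prop :=
| lin_span0 : lin_span P (cst 0)
| lin_span_cons a f g : P f -> lin_span P g ->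
    lin_span P (fun x => a * f x + g x).

Lemma lin_span_comb P a f g : lin_span P f -> lin_span P g ->
  lin_span P (fun x => a * f x + g x).
Proof.
move=> Pf Pg; elim: Pf => [|b u v Pu _ IH].
  by rewrite (_ : (fun x => _) = g)//; apply/funext => x; rewrite mulr0 add0r.
rewrite (_ : (fun x => _) = (fun x => a * b * u x + (a * v x + g x))).
  exact: lin_span_cons.
by apply/funext => x; ring.
Qed.

End LinSpan.

(** * The Haar functions span the test functions of integral zero *)

Section TestFun.
Context {R : realType} {X : pmetricType R} {Bs : set (set X)}.
Context {m : borel_measure X R}.
Hypothesis hX : ultrametric_measure_space Bs m.
Implicit Types (x y : X) (B D E : set X) (f g q : X -> R).

Let uX := ums_ultrametric hX.
Let bB := ums_basis hX.

Lemma test_fun_comb a f g : test_fun f -> test_fun g ->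
  test_fun (fun x => a * f x + g x).
Proof.
move=> [lf cf] [lg cg]; split.
  by move=> x; near=> y; congr (_ * _ + _); near: y; [exact: lf|exact: lg].
have sub : [set x | a * f x + g x != 0] `<=`
    [set x | f x != 0] `|` [set x | g x != 0].
  move=> x /=; have [->|] := eqVneq (f x) 0; last by left.
  by rewrite mulr0 add0r; right.
apply: subclosed_compact (closureS sub); first exact: closed_closure.
by rewrite closureU; exact: compactU.
Unshelve. all: by end_near. Qed.

Lemma test_fun0_comb a f g : test_fun0 m f -> test_fun0 m g ->
  m.-integrable setT (EFin \o f) -> m.-integrable setT (EFin \o g) ->
  test_fun0 m (fun x => a * f x + g x).
Proof.
move=> [tf f0] [tg g0] intf intg; split; first exact: test_fun_comb.
rewrite RintegralD//; last exact: (integrableZl measurableT _ intf).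
by rewrite RintegralZl// f0 g0 mulr0 addr0.
Qed.

Lemma integrable_comb a f g A : measurable (A : set (Borel X)) ->
  m.-integrable A (EFin \o f) -> m.-integrable A (EFin \o g) ->
  m.-integrable A (EFin \o (fun x => a * f x + g x)).
Proof.
by move=> mA intf intg; exact: integrableD (integrableZl mA _ intf) intg.
Qed.

Lemma test_fun_cst0 : test_fun (cst 0 : X -> R).
Proof.
split; first by move=> x; exact: nearW.
rewrite (_ : [set x | _] = set0) ?closure0; first exact: compact0.
by apply/seteqP; split=> x //=; rewrite eqxx.
Qed.

Lemma test_fun_ball B : Bs B -> test_fun (\1_B : X -> R).
Proof.
move=> BB; split.
  move=> x; have [Bx|nBx] := pselect (B x).
    have : nbhs x B by apply: open_nbhs_nbhs; split=> //; exact: (ball_open hX).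
    by apply: filterS => y By; rewrite !indicE !mem_set.
  have : nbhs x (~` B).
    apply: open_nbhs_nbhs; split=> //.
    by apply: closed_openC; exact: (ball_closed hX).
  by apply: filterS => y By; rewrite !indicE !memNset.
rewrite (_ : [set x | _] = B).
  by rewrite -(closure_id _).1; [case: (bb_ball bB BB)|exact: (ball_closed hX)].
apply/seteqP; split=> x /=; rewrite indicE.
  by have [/set_mem//|_] := boolP (x \in B); rewrite eqxx.
by move=> Bx; rewrite mem_set// oner_eq0.
Qed.

Lemma test_fun0_haar D : Bs D -> test_fun0 m (haar Bs m D).
Proof.
move=> BD; split; last exact: (integral_haar_super hX).
have tD := test_fun_comb (mass m D)^-1 (test_fun_ball BD) test_fun_cst0.
have := test_fun_comb (- (mass m (super Bs D))^-1)
  (test_fun_ball (super_in bB BD)) tD.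
congr test_fun; apply/funext => x; rewrite /haar /=; ring.
Qed.

Definition ball_indics : set (X -> R) := [set (\1_B : X -> R) | B in Bs].

Definition haars : set (X -> R) := [set haar Bs m D | D in Bs].

Lemma finite_cover_span (l : seq (set X)) q :
  (forall B, B \in l -> Bs B /\ forall x y, B x -> B y -> q x = q y) ->
  (forall x, q x != 0 -> exists2 B, B \in l & B x) -> lin_span ball_indics q.
Proof.
elim: l q => [|D l IH] q lq lc.
  rewrite (_ : q = cst 0); first exact: lin_span0.
  by apply/funext => x; apply: contrapT => /eqP/lc[].
have [BD qD] := lq D (mem_head _ _).
have lq' B : B \in l -> Bs B /\ forall x y, B x -> B y -> q x = q y.
  by move=> Bl; apply: lq; rewrite in_cons Bl orbT.
have [[E El DE]|nE] := pselect (exists2 E, E \in l & D `<=` E).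
  apply: IH => // x /lc[B]; rewrite in_cons => /predU1P[->|Bl] Bx.
    by exists E => //; exact: DE.
  by exists B.
have [x0 Dx0] := ball_nonempty bB BD.
rewrite (_ : q = fun x => q x0 * \1_D x + (q x - q x0 * \1_D x)); last first.
  by apply/funext => x; ring.
apply: lin_span_cons; first by exists D.
apply: IH => [B Bl|x].
  have [BB qB] := lq' B Bl; split=> // x y Bx By; rewrite (qB x y)//.
  congr (_ - _ * _).
  have sub z t : B z -> B t -> D z -> D t.
    move=> Bz Bt Dz; have [BsD|DB] := nested uX bB BB BD Bz Dz.
      exact: BsD.
    by exfalso; apply: nE; exists B.
  rewrite !indicE; have [Dx|nDx] := pselect (D x).
    by rewrite !mem_set//; exact: sub Dx.
  by rewrite !memNset//; apply: contra_not nDx; exact: sub.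
have [Dx|nDx] := pselect (D x).
  by rewrite indicE mem_set// mulr1 (qD x x0)// subrr eqxx.
rewrite indicE memNset// mulr0 subr0 => /lc[B].
by rewrite in_cons => /predU1P[->//|Bl] Bx; exists B.
Qed.

(** By local constancy, balls on which [q] is constant cover the closure of the support; compactness
    leaves finitely many. *)
Lemma test_fun_span q : test_fun q -> lin_span ball_indics q.
Proof.
move=> [lq]; rewrite compact_cover.
pose F := [set B | Bs B /\ forall x y, B x -> B y -> q x = q y].
move=> /(_ _ F id) [|x _|l lF cov].
- by move=> B [BB _]; exact: (ball_open hX).
- have [_ /(_ x _ (lq x))[B [BB Bx] qB]] := bb_basis bB.
  by exists B => //; split=> // y z By Bz; rewrite (qB y)// (qB z).
apply: (@finite_cover_span (finmap.enum_fset l)) => [B /lF/set_mem[]//|x qx].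
have [B /= Bl Bx] := cov x (@subset_closure _ [set x | q x != 0] x qx).
by exists B.
Qed.

Lemma iter_haar_span n D : Bs D -> lin_span haars (fun x =>
  (mass m D)^-1 * \1_D x -
  (mass m (iter n (super Bs) D))^-1 * \1_(iter n (super Bs) D) x).
Proof.
move=> BD; elim: n => [|n IH] /=.
  by rewrite (_ : (fun x => _) = cst 0) ?subrr; [exact: lin_span0|
    apply/funext => x; rewrite subrr].
set E := iter n _ D in IH *.
have BE : Bs E by exact: iter_super_in.
have hE : haars (haar Bs m E) by exists E.
have := lin_span_cons 1 hE IH; congr lin_span; apply/funext => x.
rewrite /haar; ring.
Qed.

(** Climb from [D] and from [E] to a common ball [F]; in the difference of the two telescoped sums
    the terms in [F] cancel. *)
Lemma ball_haar_span D E : Bs D -> Bs E -> lin_span haars (fun x =>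
  \1_D x - mass m D / mass m E * \1_E x).
Proof.
move=> BD BE; have [F [BF _ _ [i iF] [j jF]]] := bb_common bB BD BE.
have := lin_span_comb (mass m D) (iter_haar_span i BD)
  (lin_span_comb (- mass m D) (iter_haar_span j BE) (lin_span0 _)).
rewrite iF jF; congr lin_span; apply/funext => x /=.
have := mass_gt0 hX BD; have := mass_gt0 hX BE; have := mass_gt0 hX BF.
by move=> F0 E0 D0; field; rewrite !gt_eqF.
Qed.

Lemma integrable_indics_span q : lin_span ball_indics q ->
  m.-integrable setT (EFin \o q).
Proof.
elim=> [|a f g [B BB <-] _ IH]; first exact: integrable0.
by apply: integrable_comb => //; exact: (integrable_ball hX).
Qed.

Lemma integrable_haars_span q : lin_span haars q ->
  m.-integrable setT (EFin \o q).
Proof.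
elim=> [|a f g [B BB <-] _ IH]; first exact: integrable0.
by apply: integrable_comb => //; exact: (integrable_haar hX).
Qed.

(** A fixed reference ball [E] absorbs the integral of [q]. When that integral is zero the
    correction disappears and [q] itself lies in the span. *)
Lemma indics_haars_span q E : lin_span ball_indics q -> Bs E ->
  lin_span haars (fun x =>
    q x - (\int[m]_x q x) / mass m E * \1_E x).
Proof.
move=> sq BE; elim: sq => [|a f g [B BB <-] sg IH].
  rewrite (_ : (fun x => _) = cst 0); first exact: lin_span0.
  by apply/funext => x; rewrite Rintegral_cst// !mul0r subrr.
have ig := integrable_indics_span sg.
have iB := integrable_ball hX BB.
rewrite RintegralD//; last exact: (integrableZl measurableT _ iB).
rewrite RintegralZl// (integral_ball hX)// setIT.
have := lin_span_comb a (ball_haar_span BB BE) IH.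
by congr lin_span; apply/funext => x; ring.
Qed.

Lemma test_fun0_span q : test_fun0 m q <-> lin_span haars q.
Proof.
split=> [[tq q0]|].
  have [E BE _] := ball_exists bB point.
  have := indics_haars_span (test_fun_span tq) BE.
  by rewrite q0; congr lin_span; apply/funext => x; rewrite !mul0r subr0.
elim=> [|a f g [D BD <-] sg tg].
  by split; [exact: test_fun_cst0|rewrite Rintegral_cst// mul0r].
apply: test_fun0_comb => //; first exact: test_fun0_haar.
- exact: (integrable_haar hX).
- exact: integrable_haars_span.
Qed.

End TestFun.

Arguments haars {R X} Bs m.

(** * The hierarchical Laplacian and the Green operator *)

Section Eigen.
Context {R : realType} {X : pmetricType R} {Bs : set (set X)}.
Context {m : borel_measure X R} {h : set X -> int} {C : set X -> R}.
Hypotheses (hX : ultrametric_measure_space Bs m) (hh : height_function Bs h).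
Hypothesis hC : laplacian_coef Bs C h.
Implicit Types (x y : X) (B D E : set X) (f g q : X -> R).

Let uX := ums_ultrametric hX.
Let bB := ums_basis hX.

Definition balls_at x : set (set X) := [set B | Bs B /\ B x].

Lemma coef_gt0 B : Bs B -> 0 < C B.
Proof. by case: hC => + _ _; exact. Qed.

Lemma elambdaE B : Bs B -> elambda Bs C B = (lambda Bs C B)%:E.
Proof.
move=> BB; rewrite fineK// ge0_fin_numE; first by case: hC => _ + _; exact.
by apply: esum_ge0 => D [BD _]; rewrite lee_fin ltW// coef_gt0.
Qed.

(** By [super_min], the basis balls containing [B] are [B] itself and those containing its
    super-ball. *)
Lemma lambda_super B : Bs B ->
  lambda Bs C B = C B + lambda Bs C (super Bs B).
Proof.
move=> BB; have BS := super_in bB BB.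
apply: EFin_inj; rewrite EFinD -!elambdaE// /elambda.
rewrite (esumID [set B]) => [|D [BD _]]; last by rewrite lee_fin ltW// coef_gt0.
congr (_ + _)%E.
  rewrite (_ : _ `&` _ = [set B]).
    by rewrite esum_set1// lee_fin ltW ?coef_gt0.
  by apply/seteqP; split=> [D []//|D /= ->]; do 2?split.
congr esum; apply/seteqP; split=> [D [[BD BsD] nDB]|D [BD SD]].
  split=> //; apply: (super_min uX bB) => //; split=> // DsB.
  by apply: nDB; apply/seteqP.
have [sub nsub] := super_proper bB BB.
split; first by split=> //; exact: subset_trans sub SD.
by move=> /= DB; apply: nsub; move: SD; rewrite DB.
Qed.

Lemma lambda_gt0 B : Bs B -> 0 < lambda Bs C B.
Proof.
move=> BB; rewrite lambda_super// ltr_pwDl ?coef_gt0//.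
rewrite -lee_fin -elambdaE; last exact: super_in.
by apply: esum_ge0 => D [BD _]; rewrite lee_fin ltW// coef_gt0.
Qed.

Definition lap_term f x B : R :=
  C B * (f x - (mass m B)^-1 * \int[m]_(y in B) f y).

(** Strictly inside [super Bs D] the Haar function equals its average over [B]; for every other [B]
    that average is zero. *)
Lemma lap_term_haar D x B : Bs D -> balls_at x B ->
  lap_term (haar Bs m D) x B =
  haar Bs m D x * (if `[< B `<` super Bs D >] then 0 else C B).
Proof.
move=> BD [BB Bx]; rewrite /lap_term (integral_haar_ball hX BB BD Bx).
case: asboolP => _; last by rewrite mulr0 mulr0 subr0 mulrC.
by rewrite mulrCA mulVf ?gt_eqF ?(mass_gt0 hX)// mulr1 subrr !mulr0.
Qed.

(** Balls through a point of [super Bs D] are comparable with it, so those not strictly inside are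
    exactly the ones containing it; their coefficients sum to the eigenvalue. *)
Lemma esum_coef D x : Bs D -> super Bs D x ->
  (\esum_(B in balls_at x) (if `[< B `<` super Bs D >] then 0 else C B)%:E =
   elambda Bs C (super Bs D))%E.
Proof.
move=> BD Sx; have BS := super_in bB BD.
rewrite (_ : elambda _ _ _ =
    \esum_(B in balls_at x `&` [set B | super Bs D `<=` B]) (C B)%:E)%E.
  rewrite [RHS]esum_mkcondr; apply: eq_esum => B [BB Bx].
  case: asboolP => [[BsS nSB]|nBS]; first by rewrite memNset.
  rewrite mem_set//=; have [BsS|//] := nested uX bB BB BS Bx Sx.
  by apply: contrapT => nSB; apply: nBS; split.
congr esum; apply/seteqP; split=> [B [BB SB]|B [[BB Bx] SB]]; last by split.
by split=> //; split=> //; exact: SB.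
Qed.

Lemma summable_lap_haar D x : Bs D ->
  summable (balls_at x) (EFin \o lap_term (haar Bs m D) x).
Proof.
move=> BD; apply: (eq_summable (fun B Bx => esym (lap_term_haar BD Bx))).
have [Sx|nSx] := pselect (super Bs D x); last first.
  apply: (eq_summable (a := fun=> 0)) => [B _|].
    by rewrite (haar_out hX)// mul0r.
  by apply: ge0_summable => //; rewrite esum1.
apply: summableZl; apply: ge0_summable => [B [BB _]|].
  by case: ifP => // _; rewrite ltW// coef_gt0.
by rewrite (esum_coef BD Sx) elambdaE ?ltry//; exact: super_in.
Qed.

Lemma laplacian_haar D : Bs D ->
  laplacian Bs m C (haar Bs m D) =
  fun x => lambda Bs C (super Bs D) * haar Bs m D x.
Proof.
move=> BD; apply/funext => x; rewrite /laplacian.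
rewrite (eq_abs_sum (fun B Bx => lap_term_haar BD Bx)) abs_sumZ.
have [Sx|nSx] := pselect (super Bs D x); last first.
  by rewrite (haar_out hX)// mul0r mulr0.
rewrite ge0_abs_sum => [|B [BB _]]; last first.
  by case: ifP => // _; rewrite ltW// coef_gt0.
by rewrite (esum_coef BD Sx) mulrC.
Qed.

Lemma lap_term_comb a f g x B : Bs B -> m.-integrable setT (EFin \o f) ->
  m.-integrable setT (EFin \o g) ->
  lap_term (fun y => a * f y + g y) x B = a * lap_term f x B + lap_term g x B.
Proof.
move=> BB intf intg; have mB := ball_measurable hX BB.
have fB : m.-integrable B (EFin \o f) by apply: integrableS intf.
have gB : m.-integrable B (EFin \o g) by apply: integrableS intg.
rewrite /lap_term RintegralD//; last exact: (integrableZl mB _ fB).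
by rewrite RintegralZl//; ring.
Qed.

Lemma summable_lap_span q x : lin_span (haars Bs m) q ->
  summable (balls_at x) (EFin \o lap_term q x).
Proof.
elim=> [|a f g [D BD <-] sg IH].
  apply: (eq_summable (a := fun=> 0)) => [B [BB _]|].
    rewrite /lap_term Rintegral_cst ?mul0r ?mulr0 ?subr0 ?mulr0//.
    exact: (ball_measurable hX).
  by apply: ge0_summable => //; rewrite esum1.
have iD := integrable_haar hX BD; have ig := integrable_haars_span hX sg.
apply: (eq_summable (fun B (Bx : balls_at x B) =>
  esym (lap_term_comb a x Bx.1 iD ig))).
exact: summableD (summableZl a (summable_lap_haar x BD)) IH.
Qed.

Lemma laplacian_comb a D g : Bs D -> lin_span (haars Bs m) g ->
  laplacian Bs m C (fun x => a * haar Bs m D x + g x) =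
  fun x => a * lambda Bs C (super Bs D) * haar Bs m D x + laplacian Bs m C g x.
Proof.
move=> BD sg; apply/funext => x; rewrite {1}/laplacian.
have iD := integrable_haar hX BD; have ig := integrable_haars_span hX sg.
rewrite (eq_abs_sum (fun B (Bx : balls_at x B) =>
  lap_term_comb a x Bx.1 iD ig)).
rewrite abs_sumD ?abs_sumZ; last 2 first.
- exact: summableZl (summable_lap_haar x BD).
- exact: summable_lap_span.
by rewrite -mulrA -[in RHS](congr1 (@^~ x) (laplacian_haar BD)).
Qed.

Lemma laplacian0 : laplacian Bs m C (cst 0) = cst 0.
Proof.
apply/funext => x; rewrite /laplacian (@eq_abs_sum _ _ _ _ (fun=> 0 * 0)).
  by rewrite abs_sumZ mul0r.
move=> B [BB _]; rewrite Rintegral_cst; last exact: (ball_measurable hX).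
by rewrite mul0r mulr0 subr0 mulr0 mul0r.
Qed.

Lemma laplacian_span q : lin_span (haars Bs m) q ->
  lin_span (haars Bs m) (laplacian Bs m C q).
Proof.
elim=> [|a f g [D BD <-] sg IH]; first by rewrite laplacian0; exact: lin_span0.
by rewrite laplacian_comb//; apply: lin_span_cons => //; exists D.
Qed.

(** Divide each Haar coefficient by the corresponding eigenvalue, which is positive. *)
Lemma laplacian_surj q : lin_span (haars Bs m) q ->
  exists2 g, lin_span (haars Bs m) g & laplacian Bs m C g = q.
Proof.
elim=> [|a f g [D BD <-] sg [u su uE]].
  by exists (cst 0); [exact: lin_span0|exact: laplacian0].
have l0 := lambda_gt0 (super_in bB BD).
exists (fun x => a / lambda Bs C (super Bs D) * haar Bs m D x + u x).
  by apply: lin_span_cons => //; exists D.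
by rewrite laplacian_comb// uE divfK// gt_eqF.
Qed.

(** Surjectivity makes ['pinv_] return a genuine preimage inside S_0(X); [green_laplacianK] later
    determines which function this preimage is. *)
Lemma laplacian_invP q : test_fun0 m q ->
  test_fun0 m (laplacian_inv Bs m C q) /\
  laplacian Bs m C (laplacian_inv Bs m C q) = q.
Proof.
have surj : set_surj (test_fun0 m) (test_fun0 m) (laplacian Bs m C).
  move=> u /(test_fun0_span hX)/laplacian_surj[g /(test_fun0_span hX) g0 gE].
  by exists g.
move=> q0; split; last by apply: (surjpK _ surj); exact: mem_set.
by apply: (surjpinv_image_sub (dflt := fun=> cst 0) surj); exists q.
Qed.

(** * The Green operator on Haar functions *)

Section Green.
Context (W : set X -> set X -> R).
Hypothesis W_gt0 : forall B, Bs B -> 0 < W B (super Bs B).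
Hypothesis cvgW : forall k x, cvgn (weight_series Bs h m W k x).

Definition green_term f B : R :=
  (W B (super Bs B))^-1 * \int[m]_(y in B) f y.

Lemma green_term_haar D x B : Bs D -> balls_at x B ->
  green_term (haar Bs m D) B = haar Bs m D x *
    (if `[< B `<` super Bs D >] then mass m B / W B (super Bs B) else 0).
Proof.
move=> BD [BB Bx]; rewrite /green_term (integral_haar_ball hX BB BD Bx).
by case: asboolP => _; rewrite ?mulr0//; ring.
Qed.

Lemma weight_term_ge0 x j : 0 <= weight_term Bs h m W x j.
Proof.
rewrite /weight_term -(super_ball_at uX bB hh) divr_ge0//.
exact: ltW (W_gt0 (ball_at_in bB hh j x)).
Qed.

(** The balls through [x] strictly inside [super Bs D] are those of height at least [h D], one for
    each height. The tail therefore starts at [h D], even when [x] lies in the super-ball but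
    outside [D]. *)
Lemma esum_weight D x : Bs D -> super Bs D x ->
  (\esum_(B in balls_at x) (if `[< B `<` super Bs D >]
    then mass m B / W B (super Bs B) else 0)%:E =
   (limn (weight_series Bs h m W (h D) x))%:E)%E.
Proof.
move=> BD Sx; have BS := super_in bB BD; have hS := height_super hh BD.
transitivity (\esum_(B in balls_at x `&` [set B | B `<` super Bs D])
    (mass m B / W B (super Bs B))%:E)%E.
  rewrite [RHS]esum_mkcondr; apply: eq_esum => B [BB Bx].
  by case: asboolP => BS'; [rewrite mem_set|rewrite memNset].
rewrite (reindex_esum setT _ (fun n : nat => ball_at Bs h (h D + n%:Z) x)).
  rewrite -nneseries_esumT; last first.
    move=> n; rewrite super_ball_at// lee_fin; exact: weight_term_ge0.
  rewrite -EFin_lim//; congr (limn _); apply/funext => n.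
  rewrite /weight_series /series /= -sumEFin; apply: eq_bigr => k _.
  by rewrite super_ball_at.
have inS n : ball_at Bs h (h D + n%:Z) x `<` super Bs D.
  have [Bk xk hk] := ball_atP bB hh (h D + n%:Z) x.
  split; first by apply/(sub_heightE uX bB hh Bk BS xk Sx); rewrite hk; lia.
  by move=> /(sub_heightE uX bB hh BS Bk Sx xk); rewrite hk; lia.
split=> [n _|n p _ _ /(congr1 h)|B [[BB Bx] BltS]].
- have [Bk xk hk] := ball_atP bB hh (h D + n%:Z) x.
  by split; [split|exact: inS].
- by rewrite !height_ball_at//; lia.
have [sub nsub] := BltS.
have hB : h D <= h B.
  have /(sub_heightE uX bB hh BB BS Bx Sx) := sub.
  have : h B <> h (super Bs D).
    by move=> /(height_inj uX bB hh BB BS Bx Sx) BE; apply: nsub; rewrite BE.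
  by rewrite hS; lia.
exists `|h B - h D|%N => //.
by rewrite -[RHS](ball_atE uX bB hh BB Bx); congr ball_at; lia.
Qed.

Lemma summable_green_haar D x : Bs D ->
  summable (balls_at x) (EFin \o green_term (haar Bs m D)).
Proof.
move=> BD; apply: (eq_summable (fun B Bx => esym (green_term_haar BD Bx))).
have [Sx|nSx] := pselect (super Bs D x); last first.
  apply: (eq_summable (a := fun=> 0)) => [B _|].
    by rewrite (haar_out hX)// mul0r.
  by apply: ge0_summable => //; rewrite esum1.
apply: summableZl; apply: ge0_summable => [B [BB _]|].
  case: ifP => // _; rewrite divr_ge0// ltW//; last exact: W_gt0.
  exact: (mass_gt0 hX).
by rewrite (esum_weight BD Sx) ltry.
Qed.

Lemma green_haar kW D x : Bs D -> green Bs m W kW (haar Bs m D) x =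
  kW^-1 * limn (weight_series Bs h m W (h D) x) * haar Bs m D x.
Proof.
move=> BD; rewrite /green.
rewrite (eq_abs_sum (fun B Bx => green_term_haar BD Bx)) abs_sumZ.
have [Sx|nSx] := pselect (super Bs D x); last first.
  by rewrite (haar_out hX)// mul0r !mulr0.
rewrite ge0_abs_sum => [|B [BB _]].
  by rewrite (esum_weight BD Sx) /=; ring.
case: ifP => // _; rewrite divr_ge0// ltW//; last exact: W_gt0.
exact: (mass_gt0 hX).
Qed.

Lemma green_term_comb a f g B : Bs B -> m.-integrable setT (EFin \o f) ->
  m.-integrable setT (EFin \o g) ->
  green_term (fun y => a * f y + g y) B = a * green_term f B + green_term g B.
Proof.
move=> BB intf intg; have mB := ball_measurable hX BB.
have fB : m.-integrable B (EFin \o f) by apply: integrableS intf.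
have gB : m.-integrable B (EFin \o g) by apply: integrableS intg.
rewrite /green_term RintegralD//; last exact: (integrableZl mB _ fB).
by rewrite RintegralZl//; ring.
Qed.

Lemma summable_green_span q x : lin_span (haars Bs m) q ->
  summable (balls_at x) (EFin \o green_term q).
Proof.
elim=> [|a f g [D BD <-] sg IH].
  apply: (eq_summable (a := fun=> 0)) => [B [BB _]|].
    rewrite /green_term Rintegral_cst ?mul0r ?mulr0//.
    exact: (ball_measurable hX).
  by apply: ge0_summable => //; rewrite esum1.
have iD := integrable_haar hX BD; have ig := integrable_haars_span hX sg.
apply: (eq_summable (fun B (Bx : balls_at x B) =>
  esym (green_term_comb a Bx.1 iD ig))).
exact: summableD (summableZl a (summable_green_haar x BD)) IH.
Qed.

Lemma green_comb kW a D g x : Bs D -> lin_span (haars Bs m) g ->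
  green Bs m W kW (fun y => a * haar Bs m D y + g y) x =
  a * green Bs m W kW (haar Bs m D) x + green Bs m W kW g x.
Proof.
move=> BD sg; rewrite /green.
have iD := integrable_haar hX BD; have ig := integrable_haars_span hX sg.
rewrite (eq_abs_sum (fun B (Bx : balls_at x B) =>
  green_term_comb a Bx.1 iD ig)).
rewrite abs_sumD ?abs_sumZ; first by rewrite /green_term; ring.
- exact: summableZl (summable_green_haar x BD).
- exact: summable_green_span.
Qed.

Lemma green0 kW : green Bs m W kW (cst 0) = cst 0.
Proof.
apply/funext => x; rewrite /green (@eq_abs_sum _ _ _ _ (fun=> 0 * 0)).
  by rewrite abs_sumZ mul0r mulr0.
move=> B [BB _]; rewrite Rintegral_cst; last exact: (ball_measurable hX).
by rewrite mul0r mulr0 mul0r.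
Qed.

End Green.
End Eigen.

(** * The weights for which the Green operator inverts the Laplacian *)

Section Matching.
Context {R : realType} {X : pmetricType R} {Bs : set (set X)}.
Context {m : borel_measure X R} {h : set X -> int} {C : set X -> R}.
Hypotheses (hX : ultrametric_measure_space Bs m) (hh : height_function Bs h).
Hypothesis hC : laplacian_coef Bs C h.
Context (W : set X -> set X -> R) (k0 : R).
Hypothesis k0_gt0 : 0 < k0.

Let uX := ums_ultrametric hX.
Let bB := ums_basis hX.
Local Notation ball j x := (ball_at Bs h j x).
Local Notation la := (lambda Bs C).

Let la_neq0 j x : la (ball j x) != 0.
Proof. by rewrite gt_eqF// (lambda_gt0 hX hC)//; exact: ball_at_in. Qed.

Let C_neq0 j x : C (ball j x) != 0.
Proof. by rewrite gt_eqF// (coef_gt0 hC)//; exact: ball_at_in. Qed.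

Let mass_neq0 j x : mass m (ball j x) != 0.
Proof. by rewrite gt_eqF// (mass_gt0 hX)//; exact: ball_at_in. Qed.

Lemma lambda_ball_at j x : la (ball j x) = C (ball j x) + la (ball (j - 1) x).
Proof.
rewrite -(super_ball_at uX bB hh) -(lambda_super hX hC)//; exact: ball_at_in.
Qed.

Lemma matching_gt0 : matching_weight Bs m C k0 W ->
  forall B, Bs B -> 0 < W B (super Bs B).
Proof.
move=> mW B BB; rewrite mW//; apply: mulr_gt0; first by rewrite invr_gt0.
apply: divr_gt0 (coef_gt0 hC BB).
apply: mulr_gt0 (lambda_gt0 hX hC (super_in bB BB)).
exact: mulr_gt0 (mass_gt0 hX BB) (lambda_gt0 hX hC BB).
Qed.

(** The formula gives the quotient k0 C(B) / (lambda(B) lambda(B')), and C(B) = lambda(B) -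
    lambda(B') turns it into a difference of reciprocals. *)
Lemma matching_term x j : matching_weight Bs m C k0 W ->
  weight_term Bs h m W x j =
  k0 * ((la (ball (j - 1) x))^-1 - (la (ball j x))^-1).
Proof.
move=> mW; rewrite /weight_term -(super_ball_at uX bB hh) mW; last first.
  exact: ball_at_in.
rewrite (super_ball_at uX bB hh) -/(mass m _).
have := C_neq0 j x; rewrite (_ : C _ = la (ball j x) - la (ball (j - 1) x)).
  move=> C0; field.
  by rewrite C0 !la_neq0 mass_neq0 (gt_eqF k0_gt0).
by rewrite lambda_ball_at addrK.
Qed.

Lemma lambda_cvgy (j : int) x : la (ball (j + n%:Z) x) @[n --> \oo] --> +oo.
Proof.
case: hC => _ _ /(_ x)/cvgryPge lay; apply/cvgryPge => A.
have [N _ NA] := lay A.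
(* The offset [absz j] ensures [j + n >= N], so that this possibly shifted height is a natural
   number past the threshold. *)
exists (N + absz j)%N => //= n /= Nn.
have -> : j + n%:Z = (absz (j + n%:Z))%:Z by lia.
by apply: NA => /=; lia.
Qed.

Lemma matching_cvg k x : matching_weight Bs m C k0 W ->
  weight_series Bs h m W k x n @[n --> \oo] --> k0 / la (ball (k - 1) x).
Proof.
move=> mW.
(* The first [n] terms run over the heights [k] to [k + n - 1], whence the last index
   [k - 1 + n]. *)
have sE n : weight_series Bs h m W k x n =
    k0 * ((la (ball (k - 1) x))^-1 - (la (ball (k - 1 + n%:Z) x))^-1).
  rewrite /weight_series; elim: n => [|n IH].
    by rewrite /series /= big_geq// addr0 subrr mulr0.
  rewrite seriesSr IH matching_term//.
  rewrite (_ : k - 1 + n.+1%:Z = k + n%:Z); last by lia.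
  rewrite (_ : k + n%:Z - 1 = k - 1 + n%:Z); last by lia.
  by rewrite -mulrDr addrA subrK.
have -> : weight_series Bs h m W k x =
    (fun n => k0 * ((la (ball (k - 1) x))^-1 -
                    (la (ball (k - 1 + n%:Z) x))^-1)).
  exact/funext.
rewrite -[X in _ --> k0 * X]subr0.
apply: cvgMl_tmp; apply: cvgB; first exact: cvg_cst.
apply/gtr0_cvgV0; last exact: lambda_cvgy.
by apply: nearW => n; apply: (lambda_gt0 hX hC); exact: ball_at_in.
Qed.

Lemma matching_lim k x : matching_weight Bs m C k0 W ->
  limn (weight_series Bs h m W k x) = k0 / la (ball (k - 1) x).
Proof. by move=> mW; apply: cvg_lim => //; exact: matching_cvg. Qed.

Lemma matching_cvgn k x : matching_weight Bs m C k0 W ->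
  cvgn (weight_series Bs h m W k x).
Proof. by move=> mW; apply/cvg_ex; eexists; exact: matching_cvg. Qed.

(** The prefactor [k0] cancels between the weight and its tail sum. Hence the normalized tail is the
    ratio defining kappa at every height, whatever [k0] is. *)
Lemma matching_normalized j x : matching_weight Bs m C k0 W ->
  W (ball j x) (ball (j - 1) x) / fine (m (ball j x)) *
    limn (weight_series Bs h m W j x) = la (ball j x) / C (ball j x).
Proof.
move=> mW; rewrite matching_lim// -(super_ball_at uX bB hh) mW; last first.
  exact: ball_at_in.
rewrite (super_ball_at uX bB hh) -/(mass m _); field.
by rewrite C_neq0 !la_neq0 mass_neq0 (gt_eqF k0_gt0).
Qed.

Lemma limn_weight_series k x :
  (forall k x, cvgn (weight_series Bs h m W k x)) ->
  limn (weight_series Bs h m W k x) =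
  weight_term Bs h m W x k + limn (weight_series Bs h m W (k + 1) x).
Proof.
move=> cW; apply: cvg_lim => //; rewrite -cvg_shiftS.
have -> : [sequence weight_series Bs h m W k x n.+1]_n =
    (fun n => weight_term Bs h m W x k + weight_series Bs h m W (k + 1) x n).
  apply/funext => n; rewrite /weight_series /series /= big_nat_recl// addr0.
  congr (_ + _); apply: eq_bigr => i _; congr weight_term; lia.
by apply: cvgD; [exact: cvg_cst|exact: cW].
Qed.

(** Subtracting consecutive tails isolates m(B) / W(B,B') = k0 (1/lambda(B') - 1/lambda(B)), which
    is then solved for the weight. *)
Lemma matching_of_lim : (forall B, Bs B -> 0 < W B (super Bs B)) ->
  (forall k x, cvgn (weight_series Bs h m W k x)) ->
  (forall k x, limn (weight_series Bs h m W k x) = k0 / la (ball (k - 1) x)) ->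
  matching_weight Bs m C k0 W.
Proof.
move=> W_gt0 cW lW B BB; have [x Bx] := ball_nonempty bB BB.
rewrite -(ball_atE uX bB hh BB Bx); set k := h B.
have W0 : W (ball k x) (ball (k - 1) x) != 0.
  rewrite -(super_ball_at uX bB hh) gt_eqF// W_gt0//; exact: ball_at_in.
have := limn_weight_series k x cW; rewrite !lW addrK /weight_term -/(mass m _).
rewrite (super_ball_at uX bB hh).
have := C_neq0 k x; rewrite (_ : C _ = la (ball k x) - la (ball (k - 1) x)).
  have := la_neq0 k x; have := la_neq0 (k - 1) x; have := mass_neq0 k x.
  move: W0; have : k0 != 0 by rewrite gt_eqF.
  move: (la (ball k x)) (la (ball (k - 1) x)) (mass m _) (W _ _).
  (* Here [a] and [b] are lambda of the ball and of its super-ball, [M] is the mass and [w] the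
     weight; multiplying by [a * b * w] clears the denominators. *)
  move=> a b M w k00 w0 M0 b0 a0 c0 /(congr1 (fun t => t * a * b * w)) e.
  have {}e : k0 * w * (a - b) = M * a * b.
    transitivity (k0 / b * a * b * w - k0 / a * a * b * w).
      by field; rewrite a0 b0.
    by rewrite e; field; rewrite a0 w0.
  apply: (mulfI k00); apply: (mulIf c0); rewrite e.
  by field; rewrite c0 k00.
by rewrite lambda_ball_at addrK.
Qed.

End Matching.

(** * Inverting the Laplacian, and the equivalence *)

Section Main.
Context {R : realType} {X : pmetricType R} {Bs : set (set X)}.
Context {m : borel_measure X R} {h : set X -> int} {C : set X -> R}.
Hypotheses (hX : ultrametric_measure_space Bs m) (hh : height_function Bs h).
Hypothesis hC : laplacian_coef Bs C h.

Let uX := ums_ultrametric hX.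
Let bB := ums_basis hX.

Lemma locally_uniform_cvg_ptws (F : nat -> X -> R) (f : X -> R) x :
  locally_uniform_cvg F f -> F n x @[n --> \oo] --> f x.
Proof.
move=> /(_ x)[U /nbhs_singleton Ux uF].
have := uniform_subset_cvg _ _ uF.
move=> /(_ [set x] _ _); rewrite uniform_set1; apply.
by move=> y ->.
Qed.

Lemma ball_at_super D x : Bs D -> super Bs D x ->
  ball_at Bs h (h D - 1) x = super Bs D.
Proof.
move=> BD Sx; rewrite -(height_super hh BD).
exact: (ball_atE uX bB hh (super_in bB BD) Sx).
Qed.

Lemma green_matching_haar W k D : 0 < k -> matching_weight Bs m C k W -> Bs D ->
  green Bs m W k (haar Bs m D) =
  fun x => (lambda Bs C (super Bs D))^-1 * haar Bs m D x.
Proof.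
move=> k0 mW BD; apply/funext => x.
have W0 := matching_gt0 hX hC k0 mW.
have cW j y : cvgn (weight_series Bs h m W j y).
  exact: (matching_cvgn hX hh hC k0).
rewrite (green_haar hX hh W0 cW)// (matching_lim hX hh hC k0)//.
have [Sx|nSx] := pselect (super Bs D x); last by rewrite (haar_out hX)// !mulr0.
by rewrite ball_at_super// mulKf// gt_eqF.
Qed.

(** On each Haar function the two operators multiply by lambda(D') and by its inverse. A left
    inverse on the span also yields injectivity of the Laplacian there. *)
Lemma green_laplacianK W k q : 0 < k -> matching_weight Bs m C k W ->
  lin_span (haars Bs m) q -> green Bs m W k (laplacian Bs m C q) = q.
Proof.
move=> k0 mW; have W0 := matching_gt0 hX hC k0 mW.
have cW j y : cvgn (weight_series Bs h m W j y).
  exact: (matching_cvgn hX hh hC k0).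
elim=> [|a f g [D BD <-] sg IH].
  by rewrite (laplacian0 hX) (green0 hX).
rewrite (laplacian_comb hX hC)//; apply/funext => x.
rewrite (green_comb hX hh W0 cW) ?IH//; last exact: (laplacian_span hX hC).
rewrite (green_matching_haar k0 mW BD) mulrA mulfK//.
by rewrite gt_eqF// (lambda_gt0 hX hC)//; exact: super_in.
Qed.

Lemma laplacian_inv_haar D : Bs D ->
  laplacian_inv Bs m C (haar Bs m D) =
  fun x => (lambda Bs C (super Bs D))^-1 * haar Bs m D x.
Proof.
move=> BD.
(* An auxiliary matching weight with prefactor 1, built from [m] and [C] alone: its Green operator
   is a left inverse of the Laplacian and so identifies the preimage chosen by [laplacian_inv]. *)
pose W0 B D := 1^-1 * (mass m B * lambda Bs C B * lambda Bs C D / C B).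
have mW0 : matching_weight Bs m C 1 W0 by [].
have tD := test_fun0_haar hX BD.
have [/(test_fun0_span hX) sg gE] := laplacian_invP hX hC tD.
rewrite -(green_laplacianK ltr01 mW0 sg) gE.
exact: green_matching_haar.
Qed.

End Main.

Theorem theorem6p8 (R : realType) (X : pmetricType R) (Bs : set (set X))
    (m : borel_measure X R) (h : set X -> int) (C : set X -> R)
    (W : set X -> set X -> R) (kappa kappaW : R)
    (hX : ultrametric_measure_space Bs m)
    (hh : height_function Bs h)
    (hC : laplacian_coef Bs C h)
    (hW : edge_weight Bs W)
    (kappa_gt0 : 0 < kappa)
    (hkappa : locally_uniform_cvg
      (fun n x => lambda Bs C (ball_at Bs h n%:Z x) / C (ball_at Bs h n%:Z x))
      (cst kappa))
    (hkappaW : has_kappa_weight Bs h m W kappaW) :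
  [/\ (forall q, test_fun0 m q ->
         green Bs m W kappaW q = laplacian_inv Bs m C q)
        <-> matching_weight Bs m C kappa W,
      matching_weight Bs m C kappa W -> kappaW = kappa
    & forall W0 : set X -> set X -> R, edge_weight Bs W0 ->
        matching_weight Bs m C kappa W0 -> has_kappa_weight Bs h m W0 kappa].
Proof.
have uX := ums_ultrametric hX; have bB := ums_basis hX.
have [cW _ kW0 limW] := hkappaW.
have W_gt0 B : Bs B -> 0 < W B (super Bs B).
  by move=> BB; apply: (hW _ _ _).1; split=> //; [exact: super_in|left].
(* The prefactor is left arbitrary because both [kappa] and [kappaW] are substituted for it below.
   Both limits are constant in the point, so comparing them at one point suffices. *)
have kE k : 0 < k -> matching_weight Bs m C k W -> kappaW = kappa.
  move=> k0 mW; have := locally_uniform_cvg_ptws (x := point) limW.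
  have := locally_uniform_cvg_ptws (x := point) hkappa.
  rewrite (_ : (fun n => _ / fine _ * _) = (fun n : nat =>
    lambda Bs C (ball_at Bs h n%:Z point) / C (ball_at Bs h n%:Z point))).
    by move=> lk lkW; apply: cvg_unique lkW lk.
  by apply/funext => n; rewrite (matching_normalized hX hh hC k0).
split; last 2 first.
- exact: kE.
- move=> W0 _ mW0; split=> //.
  + by move=> k x; apply: (matching_cvgn hX hh hC kappa_gt0).
  (* The sum of the tail depends only on the ball of height [k - 1], so it is constant on this
     neighbourhood. *)
  + move=> k x; exists (ball_at Bs h (k - 1) x).
      exact: (nbhs_ball_at bB hh).
    rewrite /bounded_near; near=> M; move=> y xy /=.
    rewrite (matching_lim hX hh hC kappa_gt0)// (ball_at_eq uX bB hh xy).
    by near: M; exact: nbhs_pinfty_ge.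
  + rewrite (_ : (fun n x => _ / fine _ * _) = (fun (n : nat) x =>
      lambda Bs C (ball_at Bs h n%:Z x) / C (ball_at Bs h n%:Z x)))//.
    apply/funext => n; apply/funext => x.
    by rewrite (matching_normalized hX hh hC kappa_gt0).
split=> [GL|mW q q0]; last first.
  rewrite (kE _ kappa_gt0 mW).
  have [/(test_fun0_span hX) sg gE] := laplacian_invP hX hC q0.
  by rewrite -{1}gE (green_laplacianK hX hh hC kappa_gt0 mW).
(* Testing the hypothesis on the Haar function of the ball of height [k] at [x], and cancelling its
   nonzero value there, gives the tail sum kappaW / lambda(B_{k-1}(x)). The weight formula thus
   appears first with [kappaW], which [kE] then identifies with [kappa]. *)
have mW : matching_weight Bs m C kappaW W.
  apply: (matching_of_lim hX hh hC kW0 W_gt0 cW) => k x.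
  set D := ball_at Bs h k x.
  have BD : Bs D by exact: ball_at_in.
  have Sx : super Bs D x by apply: super_sub => //; exact: ball_at_mem.
  have := congr1 (@^~ x) (GL _ (test_fun0_haar hX BD)).
  rewrite (laplacian_inv_haar hX hh hC BD) /=.
  rewrite (green_haar hX hh W_gt0 cW)// (height_ball_at bB hh).
  move=> /(mulIf (haar_neq0 hX BD Sx)) e.
  by rewrite -(super_ball_at uX bB hh) -e mulVKf// gt_eqF.
by rewrite -[X in matching_weight _ _ _ X](kE _ kW0 mW).
Unshelve. all: by end_near. Qed.
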